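(* Let $(G,\mathcal{U},\varphi)$ be a self-similar ultragraph and let $s=(\alpha,A,g,\beta)$ be in $\mathcal{S}_{G,\mathcal{U}}$. For every $\mathcal{F}_{\beta x}\in\mathrm{Z}(\beta,g^{-1}\cdot A)$ with $x\in\mathcal{U}^\infty$, we have $$\theta_s(\mathcal{F}_{\beta x})=\mathcal{F}_{\alpha(g\cdot x)}.$$
   Context: **Ultragraphs.** An ultragraph $\mathcal{U}=(U^0,\mathcal{U}^1,r,s)$ consists of a set $U^0$ of vertices, a set $\mathcal{U}^1$ of edges and maps $r,s:\mathcal{U}^1\to P(U^0)\setminus\{\emptyset\}$ ($P$ = power set) such that $r(e)$ is a singleton for every $e$. Standing assumption: $\mathcal{U}$ is row-finite without sources, i.e. $\{e\in\mathcal{U}^1: r(e)=\{v\}\}$ is nonempty and finite for all $v\in U^0$. $\mathcal{U}^0$ denotes the smallest subset of $P(U^0)$ containing $\emptyset$, all $\{v\}$ ($v\in U^0$), all $s(e)$ ($e\in\mathcal{U}^1$), and closed under finite $\cap,\cup,\setminus$. A path of length $n\ge1$ is a sequence $\alpha=e_1\cdots e_n$ of edges with $r(e_{i+1})\subseteq s(e_i)$; $r(\alpha)=r(e_1)$, $s(\alpha)=s(e_n)$, $|\alpha|=n$; $\mathcal{U}^{\ge1}$ is the set of all such paths. Concatenation $\alpha\beta$ is defined when $r(\beta)\subseteq s(\alpha)$. $\mathcal{U}^\infty$ is the set of infinite paths $e_1e_2\cdots$ with $r(e_{i+1})\subseteq s(e_i)$ for all $i$. **Self-similar ultragraph.** A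 triple $(G,\mathcal{U},\varphi)$ where $\mathcal{U}=(U^0,\mathcal{U}^1,r,s)$ is a row-finite ultragraph without sources, $G$ is a countable discrete group with identity $1_G$ acting on $U^0\sqcup\mathcal{U}^1$ by ultragraph automorphisms (bijections preserving $U^0$ and $\mathcal{U}^1$ with $r(g\cdot e)=g\cdot r(e)$, $s(g\cdot e)=g\cdot s(e)$, where $g\cdot A=\{g\cdot v:v\in A\}$), and $\varphi:G\times\mathcal{U}^1\to G$ satisfies $\varphi(gh,e)=\varphi(g,h\cdot e)\varphi(h,e)$ and $\varphi(g,e)\cdot s(e)\subseteq g\cdot s(e)$. Extend to paths inductively by $g\cdot(\alpha_1\alpha_2)=(g\cdot\alpha_1)(\varphi(g,\alpha_1)\cdot\alpha_2)$, $\varphi(g,\alpha_1\alpha_2)=\varphi(\varphi(g,\alpha_1),\alpha_2)$, and to infinite paths $x=\alpha_1\alpha_2\cdots$ by $g\cdot x=(g\cdot\alpha_1)(\varphi(g,\alpha_1)\cdot\alpha_2)(\varphi(g,\alpha_1\alpha_2)\cdot\alpha_3)\cdots$. **The inverse semigroup $\mathcal{S}_{G,\mathcal{U}}$.** Add a universal path $\omega$ of length zero with $\omega\omega=\omega$, $\omega\alpha=\alpha\omega=\alpha$ (and $\omega x=x$ for infinite $x$), $s(\omega)=r(\omega)=U^0$, $g\cdot\omega=\omega$, $\varphi(g,\omega)=g$; put $\mathcal{U}^\sharp=\{\omega\}\cup\mathcal{U}^{\ge1}$. Let $\mathcal{S}_{G,\mathcal{U}}=\{(\alpha,A,g,\beta):\alpha,\beta\in\mathcal{U}^\sharp,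 A\in\mathcal{U}^0, g\in G, \emptyset\ne A\subseteq s(\alpha)\cap g\cdot s(\beta)\}\cup\{0\}$, where $0$ is a zero element, with involution $(\alpha,A,g,\beta)^*=(\beta,g^{-1}\cdot A,g^{-1},\alpha)$, $0^*=0$, and product $(\alpha,A,g,\beta)(\gamma,B,h,\delta)$ equal to - $(\alpha(g\cdot\varepsilon),\ s(g\cdot\varepsilon)\cap(\varphi(g,\varepsilon)\cdot B),\ \varphi(g,\varepsilon)h,\ \delta)$ if $\gamma=\beta\varepsilon$, $\varepsilon\in\mathcal{U}^{\ge1}$, $g\cdot r(\varepsilon)\subseteq A$; - $(\alpha,\ A\cap(g\varphi(h^{-1},\varepsilon)^{-1}\cdot s(h^{-1}\cdot\varepsilon)),\ g\varphi(h^{-1},\varepsilon)^{-1},\ \delta(h^{-1}\cdot\varepsilon))$ if $\beta=\gamma\varepsilon$, $\varepsilon\in\mathcal{U}^{\ge1}$, $r(\varepsilon)\subseteq B$; - $(\alpha,A\cap(g\cdot B),gh,\delta)$ if $\gamma=\beta$ and $A\cap(g\cdot B)\neq\emptyset$; - $0$ otherwise. This is an inverse semigroup with zero; its nonzero idempotents are $q_{(\alpha,A)}:=(\alpha,A,1_G,\alpha)$ with $\alpha\in\mathcal{U}^\sharp$, $A\in\mathcal{U}^0$, $\emptyset\ne A\subseteq s(\alpha)$. **Tight spectrum and action.** A filter in $\mathcal{E}=\mathcal{E}(\mathcal{S}_{G,\mathcal{U}})$ (the idempotents, ordered by $e\le f\iff ef=e$) is a nonempty subset closed under products and upward closed; $\widehat{\mathcal{E}}_0$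 is the set of filters not containing $0$ with the topology generated by the sets $\{\mathcal{F}:e\in\mathcal{F},e_1,\dots,e_n\notin\mathcal{F}\}$; ultrafilters are the maximal filters not containing $0$; $\mathcal{T}$ is the closure of the set of ultrafilters in $\widehat{\mathcal{E}}_0$. Put $\mathrm{Z}(\beta,B)=\{\mathcal{F}\in\mathcal{T}:q_{(\beta,B)}\in\mathcal{F}\}$. For $s\in\mathcal{S}_{G,\mathcal{U}}$, $\theta_s:\{\mathcal{F}\in\mathcal{T}:s^*s\in\mathcal{F}\}\to\{\mathcal{F}\in\mathcal{T}:ss^*\in\mathcal{F}\}$ is $\theta_s(\mathcal{F})=(s\mathcal{F}s^* )\uparrow$ (upward closure in $\mathcal{E}$). **The filters $\mathcal{F}_x$.** For $x=\alpha_1\alpha_2\cdots\in\mathcal{U}^\infty$, $$\mathcal{F}_x=\{q_{(\beta,A)}:\beta=\alpha_1\cdots\alpha_{|\beta|},\ r(\alpha_{|\beta|+1})\subseteq A\subseteq s(\beta)\}$$ (with $\beta=\omega$ when $|\beta|=0$). *)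

(* Defs.v *)
From HB Require Import structures.
From mathcomp Require Import all_boot.
From mathcomp Require Import boolp classical_sets functions cardinality.
From mathcomp Require Import topology_structure.

Set Implicit Arguments.
Unset Strict Implicit.
Unset Printing Implicit Defensive.

Local Open Scope classical_set_scope.

Record ultragraph := Ultragraph {
  vertex : Type;
  edge : Type;
  rng : edge -> set vertex;
  src : edge -> set vertex;
  rng_singleton : forall e, exists v, rng e = [set v];
  src_nonempty : forall e, src e !=set0;
  row_finite : forall v, finite_set [set e | rng e = [set v]];
  no_sources : forall v, [set e | rng e = [set v]] !=set0 }.

Arguments rng {u} e.
Arguments src {u} e.

Section Paths.
Variable U : ultragraph.

(* The family \mathcal{U}^0 of generalized vertices. *)
Definition gen_vertices : set (set (vertex U)) :=
  smallest
    (fun M : set (set (vertex U)) =>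
       [/\ setI_closed M, setU_closed M &
           forall A B, M A -> M B -> M (A `\` B)])
    [set A | [\/ A = set0, exists v, A = [set v] | exists e, A = src e]].

(* The sequences of edges in [is_path] form \mathcal{U}^\sharp: the empty
   sequence is the universal path omega, and concatenation is [++]. *)
Fixpoint is_path (a : seq (edge U)) : Prop :=
  match a with
  | e :: (f :: _) as a' => rng f `<=` src e /\ is_path a'
  | _ => True
  end.

Definition prng (a : seq (edge U)) : set (vertex U) :=
  if a is e :: _ then rng e else setT.

Definition psrc (a : seq (edge U)) : set (vertex U) :=
  if a is e :: a' then src (last e a') else setT.

(* Indexing from 0: the k-th edge of an infinite path is [x k.-1]. *)
Definition is_infpath (x : nat -> edge U) : Prop :=
  forall i, rng (x i.+1) `<=` src (x i).

Fixpoint infcat (a : seq (edge U)) (x : nat -> edge U) : nat -> edge U :=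
  if a is e :: a' then
    fun i => if i is j.+1 then infcat a' x j else e
  else x.

End Paths.

(* An action on the disjoint union of vertices and edges preserving both
   parts is given by the two actions [actv] and [acte]. *)
Record self_similar (G : groupType) (U : ultragraph) := SelfSimilar {
  group_countable : countable [set: G];
  actv : G -> vertex U -> vertex U;
  acte : G -> edge U -> edge U;
  actv1 : forall v, actv 1%g v = v;
  actvM : forall g h v, actv (g * h)%g v = actv g (actv h v);
  acte1 : forall e, acte 1%g e = e;
  acteM : forall g h e, acte (g * h)%g e = acte g (acte h e);
  rng_acte : forall g e, rng (acte g e) = actv g @` rng e;
  src_acte : forall g e, src (acte g e) = actv g @` src e;
  cocycle : G -> edge U -> G;
  cocycleM : forall g h e,
    cocycle (g * h)%g e = (cocycle g (acte h e) * cocycle h e)%g;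
  cocycle_src : forall g e,
    actv (cocycle g e) @` src e `<=` actv g @` src e }.

Section SelfSimilar.
Variables (G : groupType) (U : ultragraph) (S : self_similar G U).

Definition acts (g : G) (A : set (vertex U)) : set (vertex U) := actv S g @` A.

Fixpoint actp (g : G) (a : seq (edge U)) : seq (edge U) :=
  if a is e :: a' then acte S g e :: actp (cocycle S g e) a' else [::].

Definition pcocycle (g : G) (a : seq (edge U)) : G := foldl (cocycle S) g a.

Definition actinf (g : G) (x : nat -> edge U) : nat -> edge U :=
  fun i => acte S (pcocycle g (mkseq x i)) (x i).

(* The inverse semigroup is the subset [in_semigroup] of this type, on which
   the operations below are total; only their values on that subset matter. *)
Inductive elt : Type :=
  | Zero
  | Elt (a : seq (edge U)) (A : set (vertex U)) (g : G) (b : seq (edge U)).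

Definition in_semigroup : set elt := [set t |
  if t is Elt a A g b then
    [/\ is_path a, is_path b, gen_vertices A, A !=set0 &
        A `<=` psrc a `&` acts g (psrc b)]
  else True].

Definition star (t : elt) : elt :=
  if t is Elt a A g b then Elt b (acts g^-1%g A) g^-1%g a else Zero.

(* If [c = b ++ eps] then necessarily [eps = drop (size b) c]. *)
Definition mul (s t : elt) : elt :=
  match s, t with
  | Elt a A g b, Elt c B h d =>
    let eps := drop (size b) c in
    let eps' := drop (size c) b in
    if `[< [/\ c = b ++ eps, eps <> [::] & acts g (prng eps) `<=` A] >] then
      Elt (a ++ actp g eps)
          (psrc (actp g eps) `&` acts (pcocycle g eps) B)
          (pcocycle g eps * h)%g d
    else if `[< [/\ b = c ++ eps', eps' <> [::] & prng eps' `<=` B] >] then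
      let k := (g * (pcocycle h^-1 eps')^-1)%g in
      Elt a (A `&` acts k (psrc (actp h^-1 eps'))) k (d ++ actp h^-1 eps')
    else if `[< c = b /\ A `&` acts g B !=set0 >] then
      Elt a (A `&` acts g B) (g * h)%g d
    else Zero
  | _, _ => Zero
  end.

Definition idempotents : set elt := [set e | in_semigroup e /\ mul e e = e].

Definition ile (e f : elt) : Prop := mul e f = e.

Definition q (a : seq (edge U)) (A : set (vertex U)) : elt := Elt a A 1%g a.

Record proper_filter := ProperFilter {
  carrier : set elt;
  carrier_sub : carrier `<=` idempotents;
  carrier_nonempty : carrier !=set0;
  carrier_mul : forall e f, carrier e -> carrier f -> carrier (mul e f);
  carrier_up : forall e f, carrier e -> idempotents f -> ile e f -> carrier f;
  carrier_proper : ~ carrier Zero }.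

HB.instance Definition _ := gen_eqMixin proper_filter.
HB.instance Definition _ := gen_choiceMixin proper_filter.

Definition basic_opens : set (set proper_filter) :=
  [set O | exists e (Y : set elt),
    [/\ idempotents e, Y `<=` idempotents, finite_set Y &
        O = [set F : proper_filter | carrier F e /\ forall f, Y f -> ~ carrier F f]]].

HB.instance Definition _ :=
  @isSubBaseTopological.Build proper_filter
    (set proper_filter) basic_opens id.

Definition ultrafilters : set proper_filter :=
  [set F | forall F', carrier F `<=` carrier F' -> F' = F].

(* The tight spectrum, each filter being identified with its carrier. *)
Definition tight : set (set elt) := carrier @` closure ultrafilters.

Definition cylinder (b : seq (edge U)) (B : set (vertex U)) : set (set elt) :=
  [set F | tight F /\ F (q b B)].

Definition up_closure (X : set elt) : set elt :=
  [set f | idempotents f /\ exists2 e, X e & ile e f].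

(* To be applied to the tight filters containing [mul (star s) s]. *)
Definition theta (s : elt) (F : set elt) : set elt :=
  up_closure [set mul (mul s e) (star s) | e in F].

Definition infpath_filter (x : nat -> edge U) : set elt :=
  [set t | exists b A,
    [/\ t = q b A, gen_vertices A, b = mkseq x (size b),
        rng (x (size b)) `<=` A & A `<=` psrc b]].

End SelfSimilar.

Arguments Zero {G U}.
Arguments Elt {G U} a A g b.
Arguments q {G U} a A.
Arguments infpath_filter {G U} x.

(* Main.v *)
Require Import Defs.
From mathcomp Require Import all_boot.
From mathcomp Require Import boolp classical_sets functions cardinality.
From mathcomp Require Import topology_structure.

(** Let [s = (alpha, A, g, beta)], and write [phi] for the cocycle.  The filter
    of an infinite path [y] consists of the idempotents [q b B] for which [b]
    is a prefix of [y] and [B] contains the range of the next edge; longer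
    prefixes give smaller idempotents, and the whole filter is the upward
    closure of its elements [q b B] with [b] arbitrarily long.

    The map [theta s] conjugates by [s].  Since [q beta (g^-1 A)] lies in the
    filter of [beta x], the range of [g x] lies in [A], so the first case of
    the product applies: [g] can be pushed through every nonempty prefix [eps]
    of [x],
      [s (q (beta eps) C) s^* = q (alpha (g eps)) (s(g eps) `&` phi(g, eps) C)]
    ([conj_long]).  Conjugating [q b C] with [b] no longer than [beta] gives
    [q alpha A'] with [A'] at most cut down from [A] ([conj_short],
    [conj_same]).  As [alpha (g eps)] is a prefix of [alpha (g x)], and
    [phi(g, eps)] carries the range of the edge of [x] after [eps] to that of
    the corresponding edge of [g x], conjugation maps the filter of [beta x]
    into that of [alpha (g x)] ([conj_filter]); the latter is upward closed
    ([infpath_filter_up]), which gives one inclusion.  Conversely an element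
    [q b B] of the filter of [alpha (g x)] lies above the conjugate of
    [q (beta eps) (s(eps))] as soon as [alpha (g eps)] is longer than [b]
    ([q_prefix_le]). *)

Set Implicit Arguments.
Unset Strict Implicit.
Unset Printing Implicit Defensive.

Local Open Scope classical_set_scope.

(** * Prefixes of infinite paths *)

Section Paths.
Variable U : ultragraph.
Implicit Types (a b : seq (edge U)) (x y : nat -> edge U).

Lemma rng_nonempty (e : edge U) : rng e !=set0.
Proof. by have [v ->] := rng_singleton e; exists v. Qed.

Lemma psrc_cat a b : b <> [::] -> psrc (a ++ b) = psrc b.
Proof. by case: b => // e b _; case: a => //= f a; rewrite last_cat. Qed.

Lemma psrc_mkseqS y n : psrc (mkseq y n.+1) = src (y n).
Proof. by rewrite mkseqS -cats1 psrc_cat. Qed.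

Lemma psrc_gen_vertices a : a <> [::] -> gen_vertices (psrc a).
Proof.
case: a => // e a _; apply: sub_gen_smallest.
by apply: Or33; exists (last e a).
Qed.

Lemma gen_verticesI (A B : set (vertex U)) :
  gen_vertices A -> gen_vertices B -> gen_vertices (A `&` B).
Proof.
move=> hA hB M hM; have [[MI _ _] _] := hM.
by apply: MI; [exact: hA | exact: hB].
Qed.

Lemma rng_psrc_mkseq y n : is_infpath y -> rng (y n) `<=` psrc (mkseq y n).
Proof. by case: n => [|n] hy //; rewrite psrc_mkseqS; apply: hy. Qed.

Lemma mkseqD y n p :
  mkseq y (n + p) = mkseq y n ++ mkseq (fun i => y (n + i)) p.
Proof.
by rewrite /mkseq iotaD map_cat add0n -[n in iota n p]addn0 iotaDl -map_comp.
Qed.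

Lemma is_path_mkseq y n : is_infpath y -> is_path (mkseq y n).
Proof.
elim: n y => // n IH y hy; rewrite -[n.+1]add1n mkseqD /=.
have := IH (fun i => y i.+1) (fun i => hy i.+1).
by case: n {IH} => [|n].
Qed.

Lemma infcatD a x m : infcat a x (size a + m) = x m.
Proof. by elim: a. Qed.

Lemma infcat_size a x : infcat a x (size a) = x 0.
Proof. by rewrite -[size a]addn0 infcatD. Qed.

Lemma mkseq_infcat a x m : mkseq (infcat a x) (size a + m) = a ++ mkseq x m.
Proof.
by elim: a => //= e a <-; rewrite addSn -[(_ + m).+1]add1n mkseqD.
Qed.

Lemma mkseq_infcat_size a x : mkseq (infcat a x) (size a) = a.
Proof. by rewrite -[size a in LHS]addn0 mkseq_infcat cats0. Qed.

Lemma is_infpath_infcat a x :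
  is_path a -> is_infpath x -> rng (x 0) `<=` psrc a -> is_infpath (infcat a x).
Proof.
elim: a => // e [|f a] IH /= ha hx h0 [|i].
- exact: h0.
- exact: hx.
- by case: ha.
- by case: ha => _ ha; exact: (IH ha hx h0 i).
Qed.

End Paths.

(** * The action on generalized vertices and on paths *)

Section Action.
Variables (G : groupType) (U : ultragraph) (S : self_similar G U).
Implicit Types (a b c d : seq (edge U)) (A B C D : set (vertex U)) (g h : G).
Implicit Types (x y : nat -> edge U).

(* The bare name is also that of the product of a magma. *)
Local Notation mul := Defs.mul.

Lemma acts1 A : acts S 1%g A = A.
Proof.
rewrite eqEsubset; split=> [v [w hw <-]|v hv]; first by rewrite actv1.
by exists v; rewrite ?actv1.
Qed.

Lemma actsM g h A : acts S (g * h)%g A = acts S g (acts S h A).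
Proof.
rewrite eqEsubset; split=> [v [w hw <-]|v [_ [w hw <-] <-]].
- by exists (actv S h w); rewrite ?actvM //; exists w.
- by exists w; rewrite ?actvM.
Qed.

Lemma actsS g A B : A `<=` B -> acts S g A `<=` acts S g B.
Proof. exact: image_subset. Qed.

Lemma actsVK g A : acts S g (acts S g^-1%g A) = A.
Proof. by rewrite -actsM mulgV acts1. Qed.

Lemma actsP g A v : acts S g A v <-> A (actv S g^-1%g v).
Proof.
split=> [[w hw <-]|hv]; first by rewrite -actvM mulVg actv1.
by exists (actv S g^-1%g v) => //; rewrite -actvM mulgV actv1.
Qed.

(** The generalized vertices are generated from a family that the group
    permutes, by operations that commute with bijections. *)
Lemma acts_gen_vertices g A : gen_vertices A -> gen_vertices (acts S g A).
Proof.
move=> hA; pose M := [set B | gen_vertices (acts S g B)].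
suff: M A by [].
apply: hA; split.
  split=> B C hB hC N hN; have := hB N hN; have := hC N hN;
    case: hN => [[NI NU ND] _] NC NB.
  - suff -> : acts S g (B `&` C) = acts S g B `&` acts S g C by apply: NI.
    by apply/seteqP; split=> v; rewrite /= !actsP.
  - suff -> : acts S g (B `|` C) = acts S g B `|` acts S g C by apply: NU.
    by apply/seteqP; split=> v; rewrite /= !actsP.
  - suff -> : acts S g (B `\` C) = acts S g B `\` acts S g C by apply: ND.
    by apply/seteqP; split=> v; rewrite /= !actsP.
move=> B hB; apply: sub_gen_smallest; case: hB => [->|[v ->]|[e ->]].
- by apply: Or31; rewrite /acts image_set0.
- by apply: Or32; exists (actv S g v); rewrite /acts image_set1.
- by apply: Or33; exists (acte S g e); rewrite src_acte.
Qed.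

Lemma cocycle1 (e : edge U) : cocycle S 1%g e = 1%g.
Proof.
have := cocycleM S 1%g 1%g e; rewrite acte1 mulg1 => h.
by apply: (mulgI (cocycle S 1%g e)); rewrite mulg1 -h.
Qed.

Lemma pcocycle1 a : pcocycle S 1%g a = 1%g.
Proof. by elim: a => //= e a; rewrite cocycle1. Qed.

Lemma actp1 a : actp S 1%g a = a.
Proof. by elim: a => //= e a IH; rewrite cocycle1 acte1 IH. Qed.

Lemma actp_cat g a b :
  actp S g (a ++ b) = actp S g a ++ actp S (pcocycle S g a) b.
Proof. by elim: a g => //= e a IH g; rewrite IH. Qed.

Lemma pcocycle_rcons g a e :
  pcocycle S g (rcons a e) = cocycle S (pcocycle S g a) e.
Proof. by rewrite /pcocycle foldl_rcons. Qed.

Lemma actp_eq_nil g a : actp S g a = [::] -> a = [::].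
Proof. by case: a. Qed.

Lemma actp_mkseq g x m : actp S g (mkseq x m) = mkseq (actinf S g x) m.
Proof. by elim: m => // m IH; rewrite !mkseqS -!cats1 actp_cat IH. Qed.

Lemma rng_actinf g x m :
  rng (actinf S g x m) = acts S (pcocycle S g (mkseq x m)) (rng (x m)).
Proof. exact: rng_acte. Qed.

(** Consecutive edges of [g x] still match because the cocycle satisfies
    [phi(g, e) s(e) `<=` g s(e)]. *)
Lemma is_infpath_actinf g x : is_infpath x -> is_infpath (actinf S g x).
Proof.
move=> hx i; rewrite rng_actinf mkseqS pcocycle_rcons src_acte.
exact: subset_trans (actsS (hx i)) (@cocycle_src _ _ S _ _).
Qed.

(** * Products and idempotents *)

(** The definition of the product computes its suffixes by [drop]; this view
    replaces them by variables, so that the case analysis on a product yields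
    decompositions [c = b ++ eps] that can be substituted. *)
Variant mul_spec a A g b c B h d : elt G U -> Prop :=
  | MulR eps of c = b ++ eps & eps <> [::] & acts S g (prng eps) `<=` A :
      mul_spec a A g b c B h d
        (Elt (a ++ actp S g eps)
             (psrc (actp S g eps) `&` acts S (pcocycle S g eps) B)
             (pcocycle S g eps * h)%g d)
  | MulL eps of b = c ++ eps & eps <> [::] & prng eps `<=` B :
      mul_spec a A g b c B h d
        (let k := (g * (pcocycle S h^-1 eps)^-1)%g in
         Elt a (A `&` acts S k (psrc (actp S h^-1 eps))) k
             (d ++ actp S h^-1 eps))
  | MulE of c = b & A `&` acts S g B !=set0 :
      mul_spec a A g b c B h d (Elt a (A `&` acts S g B) (g * h)%g d)
  | Mul0 : mul_spec a A g b c B h d Zero.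

Lemma mulP a A g b c B h d :
  mul_spec a A g b c B h d (mul S (Elt a A g b) (Elt c B h d)).
Proof.
rewrite /mul; case: asboolP => [[e1 e2 e3]|_]; first exact: MulR.
case: asboolP => [[e1 e2 e3]|_]; first exact: MulL.
by case: asboolP => [[e1 e2]|_]; [exact: MulE | exact: Mul0].
Qed.

Lemma cat_neq_self (T : Type) (s t : seq T) : t <> [::] -> s <> s ++ t.
Proof.
case: t => // z t _ /(congr1 size)/eqP.
by rewrite size_cat -{1}[size s]addn0 eqn_add2l.
Qed.

Lemma mul_longr a A g b eps B h d :
  eps <> [::] -> acts S g (prng eps) `<=` A ->
  mul S (Elt a A g b) (Elt (b ++ eps) B h d) =
  Elt (a ++ actp S g eps)
      (psrc (actp S g eps) `&` acts S (pcocycle S g eps) B)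
      (pcocycle S g eps * h)%g d.
Proof. by move=> e0 hr; rewrite /mul drop_size_cat // asboolT. Qed.

Lemma mul_longl a A g c eps B h d :
  eps <> [::] -> prng eps `<=` B ->
  let k := (g * (pcocycle S h^-1 eps)^-1)%g in
  mul S (Elt a A g (c ++ eps)) (Elt c B h d) =
  Elt a (A `&` acts S k (psrc (actp S h^-1 eps))) k (d ++ actp S h^-1 eps).
Proof.
move=> e0 hr; rewrite /mul asboolF ?drop_size_cat ?asboolT //.
by case=> + _ _; rewrite -catA; apply: cat_neq_self; case: eps e0 {hr}.
Qed.

Lemma mul_same a A g b B h d :
  A `&` acts S g B !=set0 ->
  mul S (Elt a A g b) (Elt b B h d) = Elt a (A `&` acts S g B) (g * h)%g d.
Proof.
move=> hn; rewrite /mul drop_size asboolF; last by case.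
by rewrite asboolF ?asboolT //; case.
Qed.

Lemma idempotents_q b B :
  is_path b -> gen_vertices B -> B !=set0 -> B `<=` psrc b ->
  idempotents S (q b B).
Proof.
move=> pb gB B0 Bb; split; first by split; rewrite // acts1 setIid.
by rewrite mul_same acts1 setIid ?mulg1.
Qed.

(** In the two unequal cases the square of [(c, D, h, d)] has a longer first or
    last entry, so an idempotent has [c = d] and [h * h = h]. *)
Lemma idempotentP f : idempotents S f ->
  f = Zero \/ exists c D, [/\ f = q c D, gen_vertices D & D `<=` psrc c].
Proof.
case: f => [|c D h d] [hf ff]; [by left | right].
case: hf => _ _ gD _ sD.
move: ff; case: mulP => // [eps -> e0 _|eps -> e0 _|-> _] /=.
- case=> /esym h1 _ _; case: (cat_neq_self _ h1) => /actp_eq_nil; exact: e0.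
- case=> _ _ /esym h1; case: (cat_neq_self _ h1) => /actp_eq_nil; exact: e0.
- case=> _ hh; have h1 : h = 1%g by apply: (mulgI h); rewrite hh mulg1.
  by exists d, D; rewrite h1; split => // v /sD; rewrite h1 acts1 => -[].
Qed.

(** * The filter of an infinite path *)

Lemma infpath_filter_mkseq y n B :
  gen_vertices B -> rng (y n) `<=` B -> B `<=` psrc (mkseq y n) ->
  infpath_filter y (q (G := G) (mkseq y n) B).
Proof. by move=> *; exists (mkseq y n), B; split; rewrite ?size_mkseq. Qed.

Lemma infpath_filterP y (t : elt G U) : infpath_filter y t ->
  exists n B, [/\ t = q (mkseq y n) B, gen_vertices B, rng (y n) `<=` B &
                  B `<=` psrc (mkseq y n)].
Proof. by move=> [b [B [-> gB hb hr hB]]]; exists (size b), B; rewrite -hb. Qed.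

(** An idempotent above [q b B] has the form [q c D] with either [c = b] and
    [B] inside [D], or [b = c ++ eps] and the range of [eps] inside [D].  Both
    give what is asked of [D] along [y], as the first edge of [eps] is the one
    of [y] that follows [c]. *)
Lemma infpath_filter_up y e f :
  infpath_filter y e -> idempotents S f -> ile S e f -> infpath_filter y f.
Proof.
move=> /infpath_filterP[n [B [-> _ hr _]]] /idempotentP[->//|].
move=> [c [D [-> gD hD]]]; rewrite /ile.
case: mulP => // [eps _ e0 _|eps hc e0 hD'|hc _] /=.
- by case=> /esym h1; case: (cat_neq_self _ h1) => /actp_eq_nil; exact: e0.
- move=> _; have hn : n = size c + size eps.
    by rewrite -size_cat -hc size_mkseq.
  have hcat := hc; rewrite hn mkseqD in hcat.
  have hc' : mkseq y (size c) = c.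
    have := congr1 (take (size c)) hcat.
    by rewrite !take_size_cat ?size_mkseq.
  have heps : mkseq (fun i => y (size c + i)) (size eps) = eps.
    have := congr1 (drop (size c)) hcat.
    by rewrite !drop_size_cat ?size_mkseq.
  rewrite -{1}hc'; apply: infpath_filter_mkseq; rewrite ?hc' //.
  move: hD'; rewrite -heps.
  by case: (eps) e0 => //= *; rewrite -[size c]addn0.
- case=> hB *; rewrite hc in hD *; apply: infpath_filter_mkseq => //.
  by move=> v /hr; rewrite -hB acts1 => -[].
Qed.

(** Prolonging the path makes an idempotent smaller: this is the
    second case of the product, with trivial group entries. *)
Lemma q_prefix_le y n p B D :
  rng (y n) `<=` B -> D `<=` psrc (mkseq y (n + p.+1)) ->
  ile S (q (mkseq y (n + p.+1)) D) (q (mkseq y n) B).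
Proof.
rewrite /ile /q !mkseqD => hB; rewrite psrc_cat // => hD.
rewrite mul_longl //; last by rewrite /= addn0.
by rewrite invg1 pcocycle1 actp1 invg1 mulg1 acts1 (setIidl hD).
Qed.

(** * Conjugation by an element of the inverse semigroup *)

(** The right factor [star s] undoes the cocycle: multiplying by it on the
    right strips [beta] and divides by [pcocycle S g eps], so the group entry
    becomes trivial. *)
Lemma conj_long alpha A g beta eps C :
  eps <> [::] -> acts S g (prng eps) `<=` A ->
  let s := Elt alpha A g beta in
  mul S (mul S s (q (beta ++ eps) C)) (star S s) =
  q (alpha ++ actp S g eps)
    (psrc (actp S g eps) `&` acts S (pcocycle S g eps) C).
Proof.
move=> e0 hr s; rewrite /q /s /star mul_longr // mulg1.
rewrite mul_longl //; last first.
  by move=> v hv; apply/actsP; rewrite invgK; apply: hr; exists v.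
by rewrite invgK mulgV acts1 setIAC setIid.
Qed.

Lemma conj_same alpha A g beta C :
  A `&` acts S g C !=set0 ->
  let s := Elt alpha A g beta in
  mul S (mul S s (q beta C)) (star S s) = q alpha (A `&` acts S g C).
Proof.
move=> hn s; rewrite /q /s /star mul_same // mulg1.
by rewrite mul_same actsVK ?mulgV setIAC setIid.
Qed.

(** When [beta = b ++ eps] strictly prolongs [b], the idempotent [q b C] acts
    on [s] as a right identity, and [s s^*] remains. *)
Lemma conj_short alpha A g b eps C :
  eps <> [::] -> prng eps `<=` C -> A !=set0 ->
  A `<=` acts S g (psrc (b ++ eps)) ->
  let s := Elt alpha A g (b ++ eps) in
  mul S (mul S s (q b C)) (star S s) = q alpha A.
Proof.
move=> e0 hr A0; rewrite psrc_cat // => hA s.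
rewrite /q /s /star mul_longl //.
rewrite invg1 pcocycle1 actp1 invg1 mulg1 (setIidl hA).
by rewrite mul_same actsVK setIid ?mulgV.
Qed.

(** For [eps] the prefix of [x] of length [m], [g eps] is the prefix of [g x]
    of length [m] and [phi(g, eps)] carries the range of [x m] onto that of the
    [m]-th edge of [g x]; the formulas for the conjugates then match the
    definition of the filter. *)
Lemma conj_filter alpha A g beta x e :
  in_semigroup S (Elt alpha A g beta) -> is_infpath x ->
  acts S g (rng (x 0)) `<=` A -> infpath_filter (infcat beta x) e ->
  let s := Elt alpha A g beta in
  infpath_filter (infcat alpha (actinf S g x)) (mul S (mul S s e) (star S s)).
Proof.
move=> [_ _ gA A0 sA] hx hr /infpath_filterP[n [C [-> gC hC sC]]] s.
have sAa : A `<=` psrc alpha by move=> v /sA[].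
have sAb : A `<=` acts S g (psrc beta) by move=> v /sA[].
(* This covers the prefixes that do not reach beyond [beta]: conjugating
   their idempotents by [s] leaves the path [alpha]. *)
have base B : gen_vertices B -> acts S g (rng (x 0)) `<=` B -> B `<=` A ->
    infpath_filter (infcat alpha (actinf S g x)) (q (G := G) alpha B).
  move=> gB rB BA; rewrite -{2}(mkseq_infcat_size alpha (actinf S g x)).
  apply: infpath_filter_mkseq; rewrite ?infcat_size ?mkseq_infcat_size //.
  - by rewrite rng_actinf.
  - exact: subset_trans BA sAa.
have [n_gt|n_lt|n_eq] := ltngtP (size beta) n.
- move: hC sC; rewrite -(subnKC n_gt) addSnnS.
  move: (n - _) => m; rewrite mkseq_infcat infcatD => hC sC.
  rewrite conj_long // actp_mkseq -mkseq_infcat.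
  have rm := @rng_psrc_mkseq _ _ m.+1 (is_infpath_actinf (g := g) hx).
  apply: infpath_filter_mkseq.
  + apply: gen_verticesI; first exact: psrc_gen_vertices.
    exact: acts_gen_vertices.
  + rewrite infcatD subsetI; split=> //.
    by rewrite rng_actinf; apply: actsS.
  + by rewrite mkseq_infcat psrc_cat //; apply: subIsetl.
- (* The path [mkseq _ n] is a proper prefix of [beta] itself. *)
  have hb : beta = mkseq (infcat beta x) n ++
      mkseq (fun i => infcat beta x (n + i)) (size beta - n).-1.+1.
    rewrite prednK ?subn_gt0 // -mkseqD subnKC ?mkseq_infcat_size //.
    exact: ltnW.
  rewrite /s {1 3}hb conj_short -?hb //; first exact: base.
  by rewrite /= addn0.
- rewrite -n_eq mkseq_infcat_size infcat_size in hC sC *.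
  rewrite conj_same; last first.
    have [v hv] := rng_nonempty (x 0).
    exists (actv S g v); split; first by apply: hr; exists v.
    by exists v => //; apply: hC.
  apply: base; last exact: subIsetl.
  + by apply: gen_verticesI => //; apply: acts_gen_vertices.
  + by rewrite subsetI; split=> //; apply: actsS.
Qed.

End Action.

Theorem proposition7p3 (G : groupType) (U : ultragraph)
    (S : self_similar G U)
    (alpha : seq (edge U)) (A : set (vertex U)) (g : G) (beta : seq (edge U))
    (hs : in_semigroup S (Elt alpha A g beta))
    (x : nat -> edge U) (hx : is_infpath x)
    (hbx : rng (x 0) `<=` psrc beta)
    (hZ : cylinder S beta (acts S g^-1%g A) (infpath_filter (infcat beta x))) :
  theta S (Elt alpha A g beta) (infpath_filter (infcat beta x)) =
  infpath_filter (infcat alpha (actinf S g x)).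
Proof.
have hr : acts S g (rng (x 0)) `<=` A.
  case: hZ => _ [b [B [hq _ _ hB _]]]; case: hq hB => <- <- _.
  by rewrite infcat_size => /(actsS (S := S) (g := g)); rewrite actsVK.
apply/seteqP; split=> [f [idf [_ [e he <-] ef]]|].
  exact: infpath_filter_up (conj_filter hs hx hr he) idf ef.
move=> _ /infpath_filterP[n [B [-> gB hB sB]]].
case: (hs) => pa _ _ _ sA.
have hy : is_infpath (infcat alpha (actinf S g x)).
  apply: is_infpath_infcat => //; first exact: is_infpath_actinf.
  by rewrite rng_actinf; apply: subset_trans hr _ => v /sA[].
split.
  apply: idempotents_q => //; first exact: is_path_mkseq.
  by apply: subset_nonempty hB _; apply: rng_nonempty.
(* A prefix of [x] of length [n.+1] is long enough, whatever [alpha] is. *)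
pose e := q (G := G) (mkseq (infcat beta x) (size beta + n.+1)) (src (x n)).
eexists; first exists e.
- apply: infpath_filter_mkseq.
  + by rewrite -psrc_mkseqS; apply: psrc_gen_vertices.
  + by rewrite infcatD; apply: hx.
  + by rewrite mkseq_infcat psrc_cat // psrc_mkseqS.
- by [].
- rewrite /e mkseq_infcat conj_long // actp_mkseq -mkseq_infcat -addSnnS addnC.
  by apply: q_prefix_le; rewrite // addnC addSnnS mkseq_infcat psrc_cat.
Qed.
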